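(* Let $G$ be a finite abelian group, $P\subset G$ a subgroup, and $F\colon G\to\mathbb{R}$ a function. Then $$\mathrm{Var}_{\sigma\in G}[I_{P+\sigma}(F)]=\sum_{h\in P^\perp\setminus\{0\}}\bigl|\widehat F(h)\bigr|^2 .$$
   Context: $T=\{z\in\mathbb{C}\mid|z|=1\}$; $G^\vee=\mathrm{Hom}(G,T)$ is the character group of $G$, written additively with $0$ the trivial character; for $h\in G^\vee$, $g\in G$ write $h\bullet g=h(g)$. $P^\perp=\{h\in G^\vee\mid h\bullet g=1\text{ for all }g\in P\}$. The discrete Fourier transform of $F$ is $\widehat F\colon G^\vee\to\mathbb{C}$, $\widehat F(h)=|G|^{-1}\sum_{g\in G}F(g)(h\bullet g)$ (no complex conjugation). For $\sigma\in G$, $P+\sigma=\{g+\sigma\mid g\in P\}$ and $I_{P+\sigma}(F)=|P|^{-1}\sum_{g\in P}F(g+\sigma)$. $\mathrm{Var}_{\sigma\in G}$ denotes variance with respect to $\sigma$ uniformly distributed on $G$, i.e. $\mathrm{Var}_{\sigma\in G}[I_{P+\sigma}(F)]=|G|^{-1}\sum_{\sigma\in G}\bigl(I_{P+\sigma}(F)-\mathbb{E}_{\sigma\in G}[I_{P+\sigma}(F)]\bigr)^2$ with $\mathbb{E}_{\sigma\in G}[I_{P+\sigma}(F)]=|G|^{-1}\sum_{\sigma\in G}I_{P+\sigma}(F)$. *)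

(* Defs.v *)
(* The complex numbers are R[i] for R : realType.  A subgroup of G : finZmodType is
   a {group G}: the group law MathComp attaches to a finZmodType is +%R. *)
From HB Require Import structures.
From mathcomp Require Import all_boot all_order all_algebra all_fingroup cyclic.
From mathcomp Require Import complex reals.

Set Implicit Arguments.
Unset Strict Implicit.
Unset Printing Implicit Defensive.

Import GRing.Theory Num.Theory.
Local Open Scope ring_scope.
Local Open Scope complex_scope.

Section CharacterGroup.
Variables (R : realType) (G : finZmodType).

Definition unit_circle : {pred R[i]} := [pred z | `|z| == 1].

Definition is_character (h : {ffun G -> R[i]}) : bool :=
  [forall g, h g \in unit_circle] &&
  [forall g1, forall g2, h (g1 + g2) == h g1 * h g2].

Record dual := Dual {
  dual_fun :> {ffun G -> R[i]};
  dual_funP : is_character dual_fun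
}.

HB.instance Definition _ := [isSub for dual_fun].
HB.instance Definition _ := [Choice of dual by <:].

Lemma dual_norm (h : dual) g : `|h g| = 1.
Proof. by case/andP: (dual_funP h) => /forallP /(_ g) /eqP. Qed.

Lemma dualD (h : dual) g1 g2 : h (g1 + g2) = h g1 * h g2.
Proof. by case/andP: (dual_funP h) => _ /forallP /(_ g1) /forallP /(_ g2) /eqP. Qed.

Lemma dual_neq0 (h : dual) g : h g != 0.
Proof. by rewrite -normr_eq0 dual_norm oner_eq0. Qed.

Lemma dual0 (h : dual) : h 0 = 1.
Proof. by apply: (mulfI (dual_neq0 h 0)); rewrite -dualD addr0 mulr1. Qed.

Lemma dualMn (h : dual) g n : h (g *+ n) = h g ^+ n.
Proof.
by elim: n => [|n IHn]; rewrite ?mulr0n ?dual0 ?expr0 // mulrS dualD IHn exprS.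
Qed.

Lemma is_characterP (h : {ffun G -> R[i]}) :
  (forall g, `|h g| = 1) -> (forall g1 g2, h (g1 + g2) = h g1 * h g2) ->
  is_character h.
Proof.
move=> h1 hM; apply/andP; split; apply/forallP => g; first by rewrite inE h1.
by apply/forallP => g2; rewrite hM.
Qed.

Fact dual_zero_subproof : is_character [ffun=> 1].
Proof. by apply: is_characterP => *; rewrite !ffunE ?normr1 ?mulr1. Qed.
Definition dual_zero := Dual dual_zero_subproof.

Fact dual_opp_subproof (h : dual) : is_character [ffun g => (h g)^-1].
Proof.
apply: is_characterP => *; rewrite !ffunE.
  by rewrite normfV dual_norm invr1.
by rewrite dualD invfM.
Qed.
Definition dual_opp h := Dual (dual_opp_subproof h).

Fact dual_add_subproof (h1 h2 : dual) : is_character [ffun g => h1 g * h2 g].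
Proof.
apply: is_characterP => *; rewrite !ffunE.
  by rewrite normrM !dual_norm mulr1.
by rewrite !dualD mulrACA.
Qed.
Definition dual_add h1 h2 := Dual (dual_add_subproof h1 h2).

Fact dual_addA : associative dual_add.
Proof. by move=> a b c; apply/val_inj/ffunP => g; rewrite !ffunE mulrA. Qed.
Fact dual_addC : commutative dual_add.
Proof. by move=> a b; apply/val_inj/ffunP => g; rewrite !ffunE mulrC. Qed.
Fact dual_add0 : left_id dual_zero dual_add.
Proof. by move=> a; apply/val_inj/ffunP => g; rewrite !ffunE mul1r. Qed.
Fact dual_addN : left_inverse dual_zero dual_opp dual_add.
Proof. by move=> a; apply/val_inj/ffunP => g; rewrite !ffunE mulVf ?dual_neq0. Qed.

HB.instance Definition _ :=
  GRing.isZmodule.Build dual dual_addA dual_addC dual_add0 dual_addN.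

(* The dual is finite because characters take their values in the roots of
   'X^#|G| - 1. *)
Definition root_list : seq R[i] :=
  projT1 (closed_field_poly_normal ('X^#|G| - 1 : {poly R[i]})).

Lemma dual_root (h : dual) g : h g \in root_list.
Proof.
rewrite /root_list; case: closed_field_poly_normal => rs /= Ers.
have /monicP lc1 : ('X^#|G| - 1 : {poly R[i]}) \is monic.
  by rewrite monicXnsubC // -cardsT cardG_gt0.
have gG : g *+ #|G| = 0.
  by rewrite -cardsT -FinRing.zmodXgE (@expg_cardG G [set: G]%G) ?inE.
rewrite -root_prod_XsubC -[X in root X _]scale1r -lc1 -Ers.
by rewrite rootE !hornerE -dualMn gG dual0 subrr.
Qed.

Definition dual_code (h : dual) : {ffun G -> seq_sub root_list} :=
  [ffun g => SeqSub (dual_root h g)].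
Definition dual_decode (c : {ffun G -> seq_sub root_list}) : option dual :=
  insub [ffun g => ssval (c g)].

Lemma dual_codeK : pcancel dual_code dual_decode.
Proof.
move=> h; rewrite /dual_decode -[RHS](valK h); congr insub.
by apply/ffunP => g; rewrite !ffunE.
Qed.

HB.instance Definition _ : isCountable dual := PCanIsCountable dual_codeK.
HB.instance Definition _ : isFinite dual := PCanIsFinite dual_codeK.

End CharacterGroup.

Section Fourier.
Variables (R : realType) (G : finZmodType).

(* No complex conjugation on the character. *)
Definition dft (F : G -> R) (h : dual R G) : R[i] :=
  (#|G|%:R)^-1 * \sum_(g : G) (F g)%:C * h g.

Definition annihilator (P : {set G}) : {set dual R G} :=
  [set h : dual R G | [forall g in P, h g == 1]].

(* The average of F over the translate P + sigma, indexed by P. *)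
Definition coset_mean (P : {set G}) (F : G -> R) (sigma : G) : R :=
  (#|P|%:R)^-1 * \sum_(g in P) F (g + sigma).

Definition unif_expectation (X : G -> R) : R :=
  (#|G|%:R)^-1 * \sum_(sigma : G) X sigma.

Definition unif_variance (X : G -> R) : R :=
  unif_expectation (fun sigma => (X sigma - unif_expectation X) ^+ 2).

End Fourier.

(* R cannot be inferred from a set of group elements. *)
Arguments annihilator R {G} P.

(* Main.v *)
(* Characters of G trivial on P separate the points of G outside P: a common
   eigenvector f of all translations is f(0) times a character, and such an f
   is found inside the translation-stable space of P-periodic functions whose
   sums over the orbits of x vanish; that character is then nontrivial at x.
   Hence the sum of h(x) over the annihilator of P vanishes off P, and counting
   shows that it equals |G|/|P| on P.  Expanding the squares on both sides of
   the identity leaves the correlations of F along P. *)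
Require Import Defs.
From HB Require Import structures.
From mathcomp Require Import all_boot all_order all_algebra all_fingroup cyclic.
From mathcomp Require Import ring complex reals.

Set Implicit Arguments.
Unset Strict Implicit.
Unset Printing Implicit Defensive.

Import GRing.Theory Num.Theory.
Local Open Scope ring_scope.
Local Open Scope complex_scope.

(** * Eigenvectors of an operator in a stable subspace *)

Section Eigenvector.
Variables (K : closedFieldType) (V : lmodType K) (T : {linear V -> V}).

(** The operators [T - r] compose as the polynomials ['X - r%:P] multiply, so the fold evaluates
    their product at [T] on [u]. *)
Lemma foldr_prod_XsubC (rs : seq K) (u : V) :
  let p := \prod_(r <- rs) ('X - r%:P) in
  foldr (fun r v => T v - r *: v) u rs =
  \sum_(i < size p) p`_i *: iter i T u.
Proof.
elim: rs => [|r rs IH] /=.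
  by rewrite big_nil size_poly1 big_ord1 coef1 scale1r.
rewrite IH big_cons; set q := \prod_(_ <- _) _.
have q0 : q != 0 by rewrite monic_neq0 // monic_prod_XsubC.
have -> : size (('X - r%:P) * q) = (size q).+1.
  by rewrite size_proper_mul ?size_XsubC // lead_coefXsubC mul1r lead_coef_eq0.
transitivity (\sum_(i < (size q).+1)
    (('X * q)`_i *: iter i T u - r *: (q`_i *: iter i T u))); last first.
  apply: eq_bigr => i _.
  by rewrite [in RHS]mulrBl coefB mul_polyC coefZ scalerBl scalerA.
rewrite sumrB; congr (_ - _).
  rewrite big_ord_recl coefXM eqxx scale0r add0r linear_sum.
  by apply: eq_bigr => i _; rewrite coefXM linearZ.
by rewrite -scaler_sumr big_ord_recr /= nth_default // scale0r addr0.
Qed.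

(** The product of the [T - r] over the roots of ['X^n - 1] kills [u]. Applying the factors one by
    one, the last nonzero vector reached is an eigenvector, and it stays in [W]. *)
Lemma eigenvector_in_stable (W : V -> Prop) n u :
    (forall a v w, W v -> W w -> W (a *: v + w)) ->
    (forall v, W v -> W (T v)) ->
    (0 < n)%N -> iter n T u = u -> W u -> u != 0 ->
  exists r v, [/\ W v, v != 0 & T v = r *: v].
Proof.
move=> WL WT n_gt0 Tn Wu u0.
have [rs Ers] := closed_field_poly_normal ('X^n - 1 : {poly K}).
have fold0 : foldr (fun r v => T v - r *: v) u rs = 0.
  move: Ers; have /monicP -> : ('X^n - 1 : {poly K}) \is monic.
    by rewrite monicXnsubC.
  rewrite scale1r foldr_prod_XsubC => <-.
  (* Only the coefficients of degree [0] and [n] survive, leaving [iter n T u - u]. *)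
  rewrite size_XnsubC //.
  under eq_bigr => i _ do rewrite coefB coefXn coef1 scalerBl.
  rewrite sumrB big_ord_recr big1 => [|i _] /=; last first.
    by rewrite ltn_eqF // scale0r.
  rewrite big_ord_recl big1 ?addr0 => [|i _] /=; last by rewrite scale0r.
  by rewrite add0r eqxx !scale1r Tn subrr.
elim: rs {Ers} fold0 => [|r rs IH] /= fold0; first by rewrite fold0 eqxx in u0.
have [/IH // | v0] := eqVneq (foldr (fun r v => T v - r *: v) u rs) 0.
exists r, (foldr (fun r v => T v - r *: v) u rs); split=> //; last first.
  exact/subr0_eq.
elim: rs {IH fold0 v0} => //= s rs IH.
by rewrite addrC -scaleNr; apply: WL => //; apply: WT.
Qed.

End Eigenvector.

(** * Characters separating a point from a subgroup *)

Section Separation.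
Variables (R : realType) (G : finZmodType).
Local Notation C := R[i].

Definition translate (y : G) (f : {ffun G -> C}) : {ffun G -> C} :=
  [ffun g => f (g + y)].

Fact translate_is_linear y : linear (translate y).
Proof. by move=> a u v; apply/ffunP => g; rewrite !ffunE. Qed.
HB.instance Definition _ y :=
  GRing.isLinear.Build C {ffun G -> C} {ffun G -> C} _ (translate y)
    (translate_is_linear y).

Lemma mulrn_card (y : G) : y *+ #|G| = 0.
Proof.
by rewrite -cardsT -FinRing.zmodXgE (@expg_cardG G [set: G]%G) ?inE.
Qed.

Lemma iter_translate n y f g : iter n (translate y) f g = f (g + y *+ n).
Proof.
elim: n g => [|n IH] g; first by rewrite mulr0n addr0.
by rewrite /= ffunE IH mulrS addrA.
Qed.

(** Translations commute, so the vectors of [W] that are eigenvectors for the translations treated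
    so far, with fixed eigenvalues, form a space stable under the next one, which has finite
    order. *)
Lemma common_translation_eigenvector (W : {ffun G -> C} -> Prop) u :
    (forall a v w, W v -> W w -> W (a *: v + w)) ->
    (forall y v, W v -> W (translate y v)) -> W u -> u != 0 ->
  exists (r : G -> C) v,
    [/\ W v, v != 0 & forall y, translate y v = r y *: v].
Proof.
move=> WL WT Wu u0.
suff [r [v [Wv v0 Tv]]] : exists (r : G -> C) v,
    [/\ W v, v != 0 & {in enum G, forall y, translate y v = r y *: v}].
  by exists r, v; split=> // y; apply: Tv; rewrite mem_enum.
elim: (enum G) => [|z s [r [v [Wv v0 Tv]]]]; first by exists (fun=> 0), u.
pose W' w := W w /\ {in s, forall y, translate y w = r y *: w}.
have [a||||||c [w [[Ww Tw] w0 Tz]]] :=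
    @eigenvector_in_stable C _ (translate z) W' #|G| v.
- move=> v1 v2 [W1 T1] [W2 T2]; split=> [|y ys]; first exact: WL.
  by rewrite linearP /= T1 // T2 // scalerDr !scalerA mulrC.
- move=> v1 [W1 T1]; split=> [|y ys]; first exact: WT.
  rewrite -linearZ -T1 //; apply/ffunP => g.
  by rewrite !ffunE addrAC.
- by rewrite -cardsT cardG_gt0.
- by apply/ffunP => g; rewrite iter_translate mulrn_card addr0.
- by [].
- by [].
exists (fun y => if y == z then c else r y), w; split=> // y.
by rewrite inE; case: eqVneq => [->|_ /Tw].
Qed.

(** Evaluation at [0] gives [v g = r g * v 0], which forces [r] to be multiplicative; then
    [r g ^+ #|G| = 1] puts its values on the unit circle. *)
Lemma dual_of_eigenvector (r : G -> C) (v : {ffun G -> C}) :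
  v != 0 -> (forall y, translate y v = r y *: v) ->
  v 0 != 0 /\ exists h : dual R G, forall g, v g = h g * v 0.
Proof.
move=> v0 Tv.
have vD g y : v (g + y) = r y * v g.
  by move/ffunP/(_ g): (Tv y); rewrite !ffunE.
have vE g : v g = r g * v 0 by rewrite -vD add0r.
have v00 : v 0 != 0.
  apply: contra v0 => /eqP v00.
  by apply/eqP/ffunP => g; rewrite vE v00 mulr0 ffunE.
split=> //.
have rD g y : r (g + y) = r g * r y.
  by apply: (mulIf v00); rewrite -vE vD vE mulrCA mulrA.
have r0 : r 0 = 1 by apply: (mulIf v00); rewrite -vE mul1r.
have rM g n : r (g *+ n) = r g ^+ n.
  by elim: n => [|n IH]; rewrite ?mulr0n // mulrS rD IH exprS.
have hP : is_character [ffun g => r g].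
  apply: is_characterP => [g|g y]; rewrite !ffunE ?rD //.
  apply/eqP; rewrite -(@pexpr_eq1 _ _ #|G|) //.
    by rewrite -normrX -rM mulrn_card r0 normr1.
  by rewrite -cardsT cardG_gt0.
by exists (Dual hP) => g; rewrite ffunE.
Qed.

Lemma annihilatorP (P : {group G}) (h : dual R G) :
  reflect {in P, forall g, h g = 1} (h \in annihilator R P).
Proof.
rewrite inE; apply: (iffP forall_inP) => hP g gP; first exact/eqP/hP.
exact/eqP/hP.
Qed.

Lemma annihilator_separates (P : {group G}) x :
  x \notin P -> exists2 h : dual R G, h \in annihilator R P & h x != 1.
Proof.
move=> xP.
(* The first condition makes the resulting character trivial on [P]. The second excludes [h x = 1],
   which would make the sum at [0] equal to [#|G|] times [v 0]. *)
pose W (f : {ffun G -> C}) := {in P, forall p g, f (g + p) = f g} /\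
  forall g, \sum_(k < #|G|) f (g + x *+ k) = 0.
(* A translate of the indicator of [P] minus the indicator itself: its orbit sums telescope to zero,
   and [u 0 = -1] because [x] is outside [P]. *)
pose u : {ffun G -> C} := [ffun g => (g + x \in P)%:R - (g \in P)%:R].
have Pp p : p \in P -> forall g, (g + p \in P) = (g \in P).
  by move=> pP g; rewrite -FinRing.zmodMgE groupMr.
have [a||||r [v [[vP vx] v0 Tv]]] := @common_translation_eigenvector W u.
- move=> v w [vP vx] [wP wx]; split=> [p pP g|g]; first by rewrite !ffunE vP ?wP.
  under eq_bigr => k _ do rewrite !ffunE.
  by rewrite big_split -scaler_sumr /= vx wx scaler0 addr0.
- move=> y v [vP vx]; split=> [p pP g|g]; first by rewrite !ffunE addrAC vP.
  by under eq_bigr => k _ do rewrite !ffunE addrAC.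
- split=> [p pP g|g]; first by rewrite !ffunE [g + p + x]addrAC !(Pp p pP).
  under eq_bigr => k _ do rewrite !ffunE -addrA -mulrSr.
  rewrite -(big_mkord xpredT (fun k => (g + x *+ k.+1 \in P)%:R - (g + x *+ k \in P)%:R)).
  by rewrite telescope_sumr // mulrn_card mulr0n subrr.
- apply/eqP => /ffunP/(_ 0); rewrite !ffunE add0r (negbTE xP).
  by rewrite (group1 P) sub0r => /eqP; rewrite oppr_eq0 oner_eq0.
have [v00 [h vh]] := dual_of_eigenvector v0 Tv.
exists h.
  apply/annihilatorP => p pP; apply: (mulIf v00).
  by rewrite -vh -[p in LHS]add0r vP // mul1r.
apply/eqP => hx; have /eqP := vx 0.
under eq_bigr => k _ do rewrite add0r vh dualMn hx expr1n mul1r.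
rewrite sumr_const card_ord mulrn_eq0 (negbTE v00) orbF.
by rewrite -cardsT eqn0Ngt cardG_gt0.
Qed.

End Separation.

(** * Orthogonality relations and the order of the annihilator *)

Section Orthogonality.
Variables (R : realType) (G : finZmodType).
Implicit Types (h : dual R G) (P : {group G}).

Lemma dual_zeroE g : (0 : dual R G) g = 1.
Proof. exact: ffunE. Qed.

Lemma dual_addE h1 h2 g : (h1 + h2) g = h1 g * h2 g.
Proof. exact: ffunE. Qed.

Lemma dual_conj h g : (h g)^*%R = h (- g).
Proof.
apply: (mulfI (dual_neq0 h g)).
by rewrite -normCK dual_norm expr1n -dualD subrr dual0.
Qed.

Lemma dual_eq0P h : reflect (forall g, h g = 1) (h == 0).
Proof.
apply: (iffP eqP) => [-> g|h1]; first exact: dual_zeroE.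
by apply/val_inj/ffunP => g; rewrite [LHS]h1 [RHS]dual_zeroE.
Qed.

Lemma sum_dual h : \sum_g h g = if h == 0 then #|G|%:R else 0.
Proof.
case: dual_eq0P => [h1|hN1].
  by rewrite (eq_bigr (fun=> 1)) => [|g _]; rewrite ?sumr_const.
have [g0 hg0] : exists g0, h g0 != 1.
  apply/existsP; rewrite -[X in is_true X]negbK negb_exists.
  by apply/negP => /forallP h1; apply: hN1 => g; apply/eqP/negPn/h1.
(* Since [h g0 - 1] is nonzero, it suffices that multiplying the sum by [h g0] fixes it; this is the
   shift by [g0]. *)
apply/eqP; rewrite -[_ == 0]orFb -(negbTE hg0) -subr_eq0 -mulf_eq0 mulrBl mul1r.
rewrite subr_eq0 mulr_sumr [X in _ == X](reindex_inj (addrI g0)) /=.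
by apply/eqP/eq_bigr => g _; rewrite dualD.
Qed.

Lemma annihilator0 P : 0 \in annihilator R P.
Proof. by apply/annihilatorP => g _; exact: dual_zeroE. Qed.

Lemma annihilator_add P h1 h2 : h1 \in annihilator R P ->
  (h1 + h2 \in annihilator R P) = (h2 \in annihilator R P).
Proof.
move=> /annihilatorP h1P.
apply/annihilatorP/annihilatorP => hP g gP; move: (hP g gP).
  by rewrite dual_addE h1P // mul1r.
by rewrite dual_addE h1P // mul1r.
Qed.

Lemma sum_annihilator_notin P x : x \notin P ->
  \sum_(h in annihilator R P) h x = 0.
Proof.
move=> xP; have [h0 h0P hx] := annihilator_separates R xP.
apply/eqP; rewrite -[_ == 0]orFb -(negbTE hx) -subr_eq0 -mulf_eq0 mulrBl mul1r.
rewrite subr_eq0 mulr_sumr [X in _ == X](reindex_inj (addrI h0)) /=.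
apply/eqP/eq_big => h; first by rewrite annihilator_add.
by rewrite dual_addE.
Qed.

Lemma sum_annihilator_in P x : x \in P ->
  \sum_(h in annihilator R P) h x = #|annihilator R P|%:R.
Proof.
move=> xP; rewrite (eq_bigr (fun=> 1)) ?sumr_const // => h /annihilatorP.
exact.
Qed.

(** Double counting of the sum of [h x] over all [x] and all [h] in the annihilator: summing over
    [h] first, only [x] in [P] contributes; summing over [x] first, only [h = 0] does. *)
Lemma card_annihilator P : (#|annihilator R P| * #|P|)%N = #|G|.
Proof.
apply/eqP; rewrite -(eqr_nat R[i]) natrM; apply/eqP.
transitivity (\sum_x \sum_(h in annihilator R P) h x).
  rewrite (bigID (mem P)) /= [X in _ + X]big1 => [|x]; last first.
    exact: sum_annihilator_notin.
  rewrite addr0 (eq_bigr (fun=> #|annihilator R P|%:R)).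
    by rewrite sumr_const mulr_natr.
  by move=> x; apply: sum_annihilator_in.
rewrite exchange_big /= (bigD1 0) ?annihilator0 // sum_dual eqxx big1.
  exact: addr0.
by move=> h /andP[_ /negbTE h0]; rewrite sum_dual h0.
Qed.

End Orthogonality.

(** * Coset means and the second moment *)

Section Variance.
Variables (R : realType) (G : finZmodType).
Implicit Types (F X : G -> R) (P : {group G}).

Lemma natr_card_neq0 : #|G|%:R != 0 :> R.
Proof. by rewrite pnatr_eq0 -cardsT eqn0Ngt cardG_gt0. Qed.

Lemma natr_cardG_neq0 P : #|P|%:R != 0 :> R.
Proof. by rewrite pnatr_eq0 eqn0Ngt cardG_gt0. Qed.

Lemma unif_varianceE X :
  unif_variance X = unif_expectation (fun g => X g ^+ 2) - unif_expectation X ^+ 2.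
Proof.
rewrite /unif_variance; set m := unif_expectation X.
have sX : \sum_g X g = #|G|%:R * m by rewrite mulVKf ?natr_card_neq0.
rewrite /unif_expectation.
have sqrE g : (X g - m) ^+ 2 = X g ^+ 2 + (- (2 * m)) * X g + m ^+ 2 by ring.
rewrite (eq_bigr _ (fun g _ => sqrE g)) !big_split /= -mulr_sumr sX.
by rewrite sumr_const -[m ^+ 2 *+ _]mulr_natl; field; exact: natr_card_neq0.
Qed.

Lemma coset_mean_translate P F p g :
  p \in P -> coset_mean P F (p + g) = coset_mean P F g.
Proof.
move=> pP; rewrite /coset_mean; congr (_ * _).
rewrite [RHS](reindex_inj (addIr p)) /=; apply: eq_big => [x|x _].
  by rewrite -FinRing.zmodMgE groupMr.
by rewrite addrA.
Qed.

(** By invariance each shift [p] of [F] may be applied to [X] as well, and the substitution [p + g]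
    then removes it, so all [#|P|] terms agree. *)
Lemma unif_expectation_coset_mean P F X :
    (forall p g, p \in P -> X (p + g) = X g) ->
  unif_expectation (fun g => coset_mean P F g * X g) =
  unif_expectation (fun g => F g * X g).
Proof.
move=> XP; rewrite /unif_expectation /coset_mean; congr (_ * _).
transitivity (#|P|%:R^-1 * \sum_(p in P) \sum_g F (p + g) * X (p + g)).
  rewrite exchange_big mulr_sumr; apply: eq_bigr => g _.
  rewrite -mulrA mulr_suml; congr (_ * _); apply: eq_bigr => p pP.
  by rewrite XP.
rewrite (eq_bigr (fun=> \sum_g F g * X g)) => [|p _]; last first.
  by rewrite [RHS](reindex_inj (addrI p)).
by rewrite sumr_const -[(\sum_g _) *+ _]mulr_natl mulKf ?natr_cardG_neq0.
Qed.

Lemma sum_sqr_norm_dft P F :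
  \sum_(h in annihilator R P) `|dft F h| ^+ 2 =
  (unif_expectation (fun g => F g * coset_mean P F g))%:C.
Proof.
pose N : R[i] := #|G|%:R.
transitivity (N^-1 * N^-1 * \sum_g \sum_x
    (F g * F (x + g))%:C * \sum_(h in annihilator R P) h x).
  transitivity (\sum_(h in annihilator R P) N^-1 * N^-1 * \sum_g \sum_x
     (F g * F (x + g))%:C * h x).
    apply: eq_bigr => h _; rewrite normCK /dft rmorphM mulrACA.
    rewrite fmorphV rmorph_nat; congr (_ * _).
    rewrite rmorph_sum /= mulrC mulr_suml; apply: eq_bigr => g _.
    (* Passing to the difference variable turns the product of [h (- g)] and [h (x + g)] into
       [h x]. *)
    rewrite mulr_sumr [LHS](reindex_inj (addIr g)) /=; apply: eq_bigr => x _.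
    have FgC : (F g)%:C^*%R = (F g)%:C := conjc_real (F g).
    rewrite rmorphM /= dual_conj FgC mulrACA [h (- g) * _]mulrC -dualD.
    by rewrite addrK rmorphM.
  rewrite -mulr_sumr exchange_big; congr (_ * _); apply: eq_bigr => g _.
  by rewrite exchange_big; apply: eq_bigr => x _; rewrite mulr_sumr.
rewrite /unif_expectation /coset_mean rmorphM fmorphV rmorph_nat -mulrA.
congr (_ * _); rewrite rmorph_sum mulr_sumr; apply: eq_bigr => g _ /=.
rewrite (bigID (mem P)) /= [X in _ + X]big1 => [|x xP]; last first.
  by rewrite sum_annihilator_notin ?mulr0.
rewrite addr0 !rmorphM /= fmorphV rmorph_nat mulrCA rmorph_sum /= !mulr_sumr.
apply: eq_bigr => x xP.
(* The inner sum is the order of the annihilator, which turns one factor [1/#|G|] into the [1/#|P|]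
   of the coset mean. *)
rewrite sum_annihilator_in // rmorphM /= /N -(card_annihilator R P) natrM.
have A0 : #|annihilator R P|%:R != 0 :> R[i].
  by rewrite pnatr_eq0 -lt0n; apply/card_gt0P; exists 0; apply: annihilator0.
have P0 : #|P|%:R != 0 :> R[i] by rewrite pnatr_eq0 eqn0Ngt cardG_gt0.
by field; rewrite A0 P0.
Qed.

Lemma dft0 F : dft F 0 = (unif_expectation F)%:C.
Proof.
rewrite /dft /unif_expectation rmorphM fmorphV rmorph_nat rmorph_sum.
by congr (_ * _); apply: eq_bigr => g _; rewrite dual_zeroE mulr1.
Qed.

End Variance.

Theorem theorem2 (R : realType) (G : finZmodType) (P : {group G}) (F : G -> R) :
  (unif_variance (coset_mean P F))%:C =
  \sum_(h in annihilator R P :\ (0 : dual R G)) `|dft F h| ^+ 2 :> R[i].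
Proof.
have XP p g : p \in P -> coset_mean P F (p + g) = coset_mean P F g.
  exact: coset_mean_translate.
have mean : unif_expectation (coset_mean P F) = unif_expectation F.
  have := @unif_expectation_coset_mean R G P F (fun=> 1) (fun _ _ _ => erefl).
  by rewrite /unif_expectation; under eq_bigr do rewrite mulr1;
     under [in RHS]eq_bigr do rewrite mulr1.
have sqr : unif_expectation (fun g => coset_mean P F g ^+ 2) =
           unif_expectation (fun g => F g * coset_mean P F g).
  (* The coset mean is itself [P]-invariant, so it can serve as [X]. *)
  by rewrite -(unif_expectation_coset_mean F XP).
rewrite unif_varianceE mean sqr rmorphB /= -sum_sqr_norm_dft.
have mC : (unif_expectation F)%:C^*%R = (unif_expectation F)%:C := conjc_real _.
(* The term at [h = 0] is the squared mean subtracted in the variance. *)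
rewrite (big_setD1 0 (annihilator0 R P)) /= dft0 normCK mC -expr2 -rmorphXn.
by rewrite addrAC subrr add0r.
Qed.
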